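(* Let $G_1$, $G_2$ and $G_k$ be generators over alphabets $\Sigma_1$, $\Sigma_2$ and $\Sigma_k$, respectively, where $\Sigma_1\cap\Sigma_2\subseteq\Sigma_k\subseteq\Sigma_1\cup\Sigma_2$. Let $K\subseteq L_m(G_1\parallel G_2\parallel G_k)$ be a language such that $K$ and $\overline{K}$ are conditionally decomposable with respect to $\Sigma_1,\Sigma_2,\Sigma_k$. There exist nonblocking supervisors $S_1$ and $S_2$, where $S_i$ is a supervisor for the plant $G_i\parallel G_k$ with controllable events $\Sigma_{i+k,c}$ and observation projection $Q_{i+k}$, such that $L_m(S_i/[G_i\parallel G_k])\subseteq P_{i+k}(K)$ for $i=1,2$ and $$L_m(S_1/[G_1\parallel G_k])\parallel L_m(S_2/[G_2\parallel G_k])=K$$ if and only if $K$ is (i) conditionally controllable for $G_1,G_2,G_k$, (ii) conditionally closed for $G_1,G_2,G_k$, and (iii) conditionally observable for $G_1,G_2,G_k$ and the projections $Q_{1+k},Q_{2+k}$.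
   Context: A generator is $G=(Q,\Sigma,f,q_0,Q_m)$ with finite state set $Q$, finite nonempty alphabet $\Sigma$, partial transition function $f:Q\times\Sigma\to Q$ (extended to words), initial state $q_0$ and marked states $Q_m\subseteq Q$; $L(G)=\{s\in\Sigma^*\mid f(q_0,s)\text{ is defined}\}$ and $L_m(G)=\{s\mid f(q_0,s)\in Q_m\}$. $\overline{L}$ denotes the prefix closure of $L$. A (natural) projection $\Sigma^*\to\Sigma_0^*$, $\Sigma_0\subseteq\Sigma$, erases the letters not in $\Sigma_0$. For $L_i\subseteq\Sigma_i^*$, $L_1\parallel L_2=P_1^{-1}(L_1)\cap P_2^{-1}(L_2)$, where $P_i:(\Sigma_1\cup\Sigma_2)^*\to\Sigma_i^*$ are the projections; for generators $\parallel$ is the synchronous product, satisfying $L(G_1\parallel G_2)=L(G_1)\parallel L(G_2)$ and $L_m(G_1\parallel G_2)=L_m(G_1)\parallel L_m(G_2)$. The global alphabet $\Sigma=\Sigma_1\cup\Sigma_2$ is partitioned into controllable events $\Sigma_c$ and uncontrollable events $\Sigma_u=\Sigma\setminus\Sigma_c$, and $\Sigma_o\subseteq\Sigma$ is the set of observable events. Put $\Sigma_{i+k}=\Sigma_i\cup\Sigma_k$, $\Sigma_{i+k,c}=\Sigma_{i+k}\cap\Sigma_c$, $\Sigma_{i+k,u}=\Sigma_{i+k}\cap\Sigma_u$, $\Sigma_{i+k,o}=\Sigma_{i+k}\cap\Sigma_o$. $P_{i+k}:\Sigma^*\to\Sigma_{i+k}^*$ and $Q_{i+k}:\Sigma_{i+k}^*\to\Sigma_{i+k,o}^*$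 are projections. Supervisors: for a generator $G$ over an alphabet $A$ with controllable events $A_c$, uncontrollable events $A_u=A\setminus A_c$ and observation projection $Q:A^*\to A_o^*$, a supervisor is a map $S:Q(L(G))\to\Gamma=\{\gamma\subseteq A\mid A_u\subseteq\gamma\}$. The closed-loop language $L(S/G)$ is the smallest language such that $\varepsilon\in L(S/G)$ and, if $s\in L(S/G)$, $sa\in L(G)$ and $a\in S(Q(s))$, then $sa\in L(S/G)$. Moreover $L_m(S/G)=L(S/G)\cap L_m(G)$, and $S$ is nonblocking if $\overline{L_m(S/G)}=L(S/G)$. A language $M$ is controllable with respect to $L(G)$ and $A_u$ if $\overline{M}A_u\cap L(G)\subseteq\overline{M}$; it is $L_m(G)$-closed if $M=\overline{M}\cap L_m(G)$; it is observable with respect to $L(G)$, $A_c$ and $Q$ if for all $s\in\overline{M}$ and $\sigma\in A_c$, $s\sigma\notin\overline{M}$ and $s\sigma\in L(G)$ imply $Q^{-1}[Q(s)]\sigma\cap\overline{M}=\emptyset$. A language $M\subseteq\Sigma^*$ is conditionally decomposable with respect to $\Sigma_1,\Sigma_2,\Sigma_k$ if $M=P_{1+k}(M)\parallel P_{2+k}(M)$. A language $M\subseteq L_m(G_1\parallel G_2\parallel G_k)$ is: conditionally controllable for $G_1,G_2,G_k$ if, for $i=1,2$, $P_{i+k}(M)$ is controllable with respect to $L(G_i\parallel G_k)$ and $\Sigma_{i+k,u}$; conditionally closed for $G_1,G_2,G_k$ if $M$ is nonempty and, for $i=1,2$, $P_{i+k}(M)$ is $L_m(G_i\parallel G_k)$-closed;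 conditionally observable for $G_1,G_2,G_k$ and $Q_{1+k},Q_{2+k}$ if, for $i=1,2$, $P_{i+k}(M)$ is observable with respect to $L(G_i\parallel G_k)$, $\Sigma_{i+k,c}$ and $Q_{i+k}$. *)

(* Defs.v *)
From mathcomp Require Import all_boot.
From mathcomp Require Import boolp classical_sets.

Set Implicit Arguments.
Unset Strict Implicit.
Unset Printing Implicit Defensive.

Local Open Scope classical_set_scope.

(* Alphabets are finite sets [A : {set E}] of events of an ambient finite type
   [E]; a language, possibly non-regular, is a [set (seq E)]. *)
Section Languages.
Variable E : finType.
Implicit Types (A B : {set E}) (L M : set (seq E)).

Definition words A : set (seq E) := [set w | all (mem A) w].

Definition pclosure L : set (seq E) := [set s | exists2 w, L w & prefix s w].

Definition proj B (w : seq E) : seq E := [seq a <- w | a \in B].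

(* The inverse image of [L] under the projection from [words A] to [words B];
   its members are words over [A] only. *)
Definition invproj A B L : set (seq E) := words A `&` proj B @^-1` L.

Definition parallel A1 A2 L1 L2 : set (seq E) :=
  invproj (A1 :|: A2) A1 L1 `&` invproj (A1 :|: A2) A2 L2.

Definition cat_letters L B : set (seq E) :=
  [set w | exists s a, [/\ L s, a \in B & w = rcons s a]].

End Languages.

(* A generator over [A]. The partial function [Q * A -> Q] is encoded as an
   [option]-valued function that is undefined on the events outside [A]. *)
Record generator (E : finType) (A : {set E}) := Generator {
  state : finType;
  trans : state -> E -> option state;
  init : state;
  marked : {set state};
  alphabet_neq0 : 0 < #|A|;
  trans_alphabet : forall q a, a \notin A -> trans q a = None
}.

Section Generators.
Variable E : finType.
Implicit Types A : {set E}.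

Definition run A (G : generator A) (w : seq E) : option (state G) :=
  foldl (fun oq a => obind (fun q => trans q a) oq) (Some (init G)) w.

Definition lang A (G : generator A) : set (seq E) := [set w | run G w].

Definition mlang A (G : generator A) : set (seq E) :=
  [set w | exists2 q, run G w = Some q & q \in marked G].

Section Sync.
Variables (A1 A2 : {set E}) (G1 : generator A1) (G2 : generator A2).

Definition sync_trans (q : state G1 * state G2) (a : E) :
    option (state G1 * state G2) :=
  match a \in A1, a \in A2 with
  | true, true =>
      if (trans q.1 a, trans q.2 a) is (Some q1, Some q2)
      then Some (q1, q2) else None
  | true, false => omap (fun q1 => (q1, q.2)) (trans q.1 a)
  | false, true => omap (fun q2 => (q.1, q2)) (trans q.2 a)
  | false, false => None
  end.

Lemma sync_alphabet_neq0 : 0 < #|A1 :|: A2|.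
Proof.
exact: leq_trans (alphabet_neq0 G1) (subset_leq_card (finset.subsetUl A1 A2)).
Qed.

Lemma sync_trans_alphabet q a : a \notin A1 :|: A2 -> sync_trans q a = None.
Proof.
by rewrite /sync_trans finset.in_setU; case: (a \in A1) (a \in A2) => [] [].
Qed.

Definition sync : generator (A1 :|: A2) :=
  @Generator E (A1 :|: A2) (state G1 * state G2)%type sync_trans
    (init G1, init G2) (finset.setX (marked G1) (marked G2))
    sync_alphabet_neq0 sync_trans_alphabet.

Lemma run_sync w : words (A1 :|: A2) w ->
  run sync w = if (run G1 (proj A1 w), run G2 (proj A2 w)) is (Some q1, Some q2)
               then Some (q1, q2) else None.
Proof.
rewrite /run /words /=; elim/last_ind: w => [//|w a IHw].
rewrite all_rcons => /andP[aA /IHw]; rewrite /proj !filter_rcons foldl_rcons => ->.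
move: aA; rewrite -[mem _ a]/(a \in _) finset.in_setU.
rewrite -/(proj A1 w) -/(proj A2 w) -/(run G1 _) -/(run G2 _).
case a1: (a \in A1); case a2: (a \in A2) => //= _; rewrite ?foldl_rcons /sync_trans;
  rewrite -?/(run G1 _) -?/(run G2 _);
  case: (run G1 _) => [q1|] //=; case: (run G2 _) => [q2|] //=; rewrite ?a1 ?a2;
  by do 2?[case: (trans _ a) => //= ?].
Qed.

End Sync.

(* The words read by a generator are words over its alphabet, although [run]
   accepts arbitrary sequences of events. *)
Lemma lang_words A (G : generator A) : lang G `<=` words A.
Proof.
move=> w; rewrite /lang /words /run /=; elim/last_ind: w => [//|w a IHw].
rewrite foldl_rcons all_rcons; case: (foldl _ _ w) IHw => [q|] //= -> //.
by case: (boolP (a \in A)) => // /trans_alphabet ->.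
Qed.

Lemma lang_sync A1 A2 (G1 : generator A1) (G2 : generator A2) :
  lang (sync G1 G2) = parallel A1 A2 (lang G1) (lang G2).
Proof.
apply/seteqP; split=> [w Lw | w [[ww L1] [_ L2]]].
  have ww := lang_words Lw; move: Lw; rewrite /lang /= run_sync //.
  case r1: (run G1 (proj A1 w)) => [q1|] //.
  case r2: (run G2 (proj A2 w)) => [q2|] // _.
  by split; split=> //; rewrite /= ?r1 ?r2.
rewrite /lang /= run_sync //; move: L1 L2; rewrite /lang /=.
by case: (run G1 (proj A1 w)) => // q1; case: (run G2 (proj A2 w)).
Qed.

Lemma mlang_sync A1 A2 (G1 : generator A1) (G2 : generator A2) :
  mlang (sync G1 G2) = parallel A1 A2 (mlang G1) (mlang G2).
Proof.
apply/seteqP; split=> [w [q rw mq] | w [[ww [q1 r1 m1]] [_ [q2 r2 m2]]]].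
  have ww : words (A1 :|: A2) w.
    by apply: (@lang_words _ (sync G1 G2)); rewrite /lang /= rw.
  move: rw; rewrite run_sync //.
  case r1: (run G1 (proj A1 w)) => [q1|] //.
  case r2: (run G2 (proj A2 w)) => [q2|] // -[eq_q].
  move: mq; rewrite -eq_q finset.in_setX => /andP[m1 m2].
  by split; split=> //; [exists q1 | exists q2].
by exists (q1, q2); rewrite ?run_sync ?r1 ?r2 // finset.in_setX m1.
Qed.

End Generators.

Section Supervisors.
Variables (E : finType) (A : {set E}) (G : generator A) (Ac Ao : {set E}).

Definition control_patterns : set {set E} :=
  [set gamma | A :\: Ac \subset gamma /\ gamma \subset A].

(* Only the values on the observations of words of [lang G] are constrained;
   the other values are irrelevant, as [closed_loop] never uses them. *)
Record supervisor := Supervisor {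
  control :> seq E -> {set E};
  control_in : forall t, (proj Ao @` lang G) t -> control_patterns (control t)
}.

Inductive closed_loop (S : supervisor) : set (seq E) :=
| closed_loop_nil : closed_loop S [::]
| closed_loop_rcons s a :
    closed_loop S s -> lang G (rcons s a) -> a \in S (proj Ao s) ->
    closed_loop S (rcons s a).

Definition closed_loop_marked (S : supervisor) : set (seq E) :=
  closed_loop S `&` mlang G.

Definition nonblocking (S : supervisor) : Prop :=
  pclosure (closed_loop_marked S) = closed_loop S.

End Supervisors.

Section LanguageProperties.
Variable E : finType.
Implicit Types (L M : set (seq E)).

Definition controllable L (Au : {set E}) M : Prop :=
  cat_letters (pclosure M) Au `&` L `<=` pclosure M.

Definition mclosed (Lm : set (seq E)) M : Prop := M = pclosure M `&` Lm.

(* [A] is the domain alphabet and [Ao] the codomain alphabet of the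
   observation projection. *)
Definition observable L (Ac A Ao : {set E}) M : Prop :=
  forall s a, pclosure M s -> a \in Ac ->
    ~ pclosure M (rcons s a) -> L (rcons s a) ->
    cat_letters (invproj A Ao [set proj Ao s]) [set a]%SET `&` pclosure M = set0.

Definition cond_decomposable (A1 A2 Ak : {set E}) M : Prop :=
  M = parallel (A1 :|: Ak) (A2 :|: Ak)
        (proj (A1 :|: Ak) @` M) (proj (A2 :|: Ak) @` M).

Variables (A1 A2 Ak : {set E}).
Variables (G1 : generator A1) (G2 : generator A2) (Gk : generator Ak).

Definition cond_controllable (Sigmau : {set E}) M : Prop :=
  controllable (lang (sync G1 Gk)) ((A1 :|: Ak) :&: Sigmau)
    (proj (A1 :|: Ak) @` M) /\
  controllable (lang (sync G2 Gk)) ((A2 :|: Ak) :&: Sigmau)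
    (proj (A2 :|: Ak) @` M).

Definition cond_closed M : Prop :=
  [/\ M !=set0,
      mclosed (mlang (sync G1 Gk)) (proj (A1 :|: Ak) @` M) &
      mclosed (mlang (sync G2 Gk)) (proj (A2 :|: Ak) @` M)].

Definition cond_observable (Sigmac Sigmao : {set E}) M : Prop :=
  observable (lang (sync G1 Gk)) ((A1 :|: Ak) :&: Sigmac)
    (A1 :|: Ak) ((A1 :|: Ak) :&: Sigmao) (proj (A1 :|: Ak) @` M) /\
  observable (lang (sync G2 Gk)) ((A2 :|: Ak) :&: Sigmac)
    (A2 :|: Ak) ((A2 :|: Ak) :&: Sigmao) (proj (A2 :|: Ak) @` M).

End LanguageProperties.

(* Main.v *)
(* For a single plant [G], a nonempty [M] is the marked language of a
   nonblocking closed loop iff it is controllable, [mlang G]-closed and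
   observable: the supervisor enables, after an observation [t], the
   uncontrollable events and those extending within the closure of [M] some word
   observed as [t]. The inclusions in [proj @` K] force the two marked closed
   loops to be exactly the projections of [K], since [K], being their parallel
   composition, projects into each of them; so the theorem is the single-plant
   statement applied twice, with conditional decomposability of [K]. *)
Require Import Defs.
From mathcomp Require Import all_boot.
From mathcomp Require Import boolp classical_sets.

Set Implicit Arguments.
Unset Strict Implicit.
Unset Printing Implicit Defensive.

Local Open Scope classical_set_scope.

Section PrefixClosure.
Variable E : finType.
Implicit Types (L M : set (seq E)) (s : seq E).

Lemma pclosure_rcons L s a : pclosure L (rcons s a) -> pclosure L s.
Proof. by case=> w Lw /(prefix_trans (prefix_rcons s a)) sw; exists w. Qed.

Lemma pclosure_nil L : L !=set0 -> pclosure L [::].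
Proof. by case=> w Lw; exists w => //; exact: prefix0s. Qed.

Lemma pclosure_nonempty L s : pclosure L s -> L !=set0.
Proof. by case=> w Lw _; exists w. Qed.

Lemma lang_prefix (A : {set E}) (G : generator A) s w :
  prefix s w -> lang G w -> lang G s.
Proof.
move=> /prefixP[t ->]; rewrite /lang /= /run foldl_cat.
(* An undefined run on [s] stays undefined along [t]. *)
by case: (foldl _ _ s) => //; elim: t.
Qed.

Lemma pclosure_mlang (A : {set E}) (G : generator A) :
  pclosure (mlang G) `<=` lang G.
Proof.
by move=> s [w [q rw _]] /lang_prefix; apply; rewrite /lang /= rw.
Qed.

Lemma pclosureS L M : L `<=` M -> pclosure L `<=` pclosure M.
Proof. by move=> LM s [w /LM Mw sw]; exists w. Qed.

Lemma proj_parallel1 (A1 A2 : {set E}) L1 L2 :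
  proj A1 @` parallel A1 A2 L1 L2 `<=` L1.
Proof. by move=> _ [w [[_ L1w] _] <-]. Qed.

Lemma proj_parallel2 (A1 A2 : {set E}) L1 L2 :
  proj A2 @` parallel A1 A2 L1 L2 `<=` L2.
Proof. by move=> _ [w [_ [_ L2w]] <-]. Qed.

End PrefixClosure.

Section SinglePlant.
Variables (E : finType) (A : {set E}) (G : generator A) (Ac Ao : {set E}).

Section ClosedLoop.
Variable S : supervisor G Ac Ao.

Lemma closed_loop_lang : closed_loop S `<=` lang G.
Proof. by move=> s [|s' a]. Qed.

Lemma closed_loop_rconsE s a : closed_loop S (rcons s a) ->
  [/\ closed_loop S s, lang G (rcons s a) & a \in control S (proj Ao s)].
Proof.
move Ew: (rcons s a) => w Cw.
case: Cw Ew => [|s' a' Cs' Ls' Sa' /rcons_inj[-> ->] //].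
by case: s.
Qed.

Hypothesis nbS : nonblocking S.

(** Nonblocking replaces the prefix closure by the closed loop itself, and every control pattern
    contains the uncontrollable events. *)
Lemma nonblocking_controllable :
  controllable (lang G) (A :\: Ac) (closed_loop_marked S).
Proof.
rewrite /controllable nbS => _ [[s [a [Cs aAu ->]]] Lsa].
apply: closed_loop_rcons => //.
have [] := @control_in _ _ _ _ _ S (proj Ao s) _.
  by exists s => //; exact: closed_loop_lang.
by move=> /fintype.subsetP sub _; exact: sub.
Qed.

Lemma nonblocking_mclosed : mclosed (mlang G) (closed_loop_marked S).
Proof. by rewrite /mclosed nbS. Qed.

(** The decision of [S] depends on the observation alone: an event enabled after [s'] is enabled
    after every [s] with the same projection. *)
Lemma nonblocking_observable :
  observable (lang G) Ac A Ao (closed_loop_marked S).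
Proof.
rewrite /observable nbS => s a Cs _ nCsa Lsa; apply/seteqP; split=> // w.
case=> -[s' [_ [[_ obs] /finset.set1P -> ->]]] /closed_loop_rconsE[_ _ Sa].
by apply: nCsa; apply: closed_loop_rcons => //; rewrite -obs.
Qed.

(** The empty word is in the closed loop, so by nonblocking it is a prefix of some marked word. *)
Lemma nonblocking_nonempty : closed_loop_marked S !=set0.
Proof.
apply: (@pclosure_nonempty _ _ [::]); rewrite nbS; exact: closed_loop_nil.
Qed.

End ClosedLoop.

Section Synthesis.
Variable M : set (seq E).

(** Restricting to [A] and always enabling the events outside [Ac] makes each value a control
    pattern, whatever [M] is. As [M] is arbitrary, the existence test is a classical boolean. *)
Definition permissive_control (t : seq E) : {set E} :=
  [set a in A | (a \notin Ac) ||
     `[< exists2 s, proj Ao s = t & pclosure M (rcons s a) >]]%SET.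

Lemma permissive_control_in t :
  (proj Ao @` lang G) t -> control_patterns A Ac (permissive_control t).
Proof.
move=> _; split; apply/fintype.subsetP => a; rewrite !finset.inE.
  by case/andP=> -> ->.
by case/andP.
Qed.

Definition permissive_supervisor : supervisor G Ac Ao :=
  Supervisor permissive_control_in.

Hypotheses (M0 : M !=set0) (Mctrl : controllable (lang G) (A :\: Ac) M)
  (Mclosed : mclosed (mlang G) M) (Mobs : observable (lang G) Ac A Ao M).

Let pclosureM_lang : pclosure M `<=` lang G.
Proof.
apply: subset_trans (@pclosure_mlang _ _ G); apply: pclosureS.
by rewrite Mclosed => w [].
Qed.

(** Both inclusions go by induction on the word. An enabled event keeps it in the closure by
    observability if controllable, by controllability of [M] otherwise; conversely, [s] itself
    witnesses that the next event is enabled. *)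
Lemma permissive_closed_loop : closed_loop permissive_supervisor = pclosure M.
Proof.
apply/seteqP; split=> [s|].
  elim=> [|{}s a _ Ms Lsa]; first exact: pclosure_nil.
  rewrite /= finset.inE => /andP[aA].
  have [aAc /= /asboolP[s' obs Ms'a]|aAc _] := boolP (a \in Ac); last first.
    apply: Mctrl; split=> //; exists s, a; split=> //.
    by rewrite finset.in_setD aAc.
  (* If [rcons s a] left the closure, observability would exclude [rcons s' a] from it, where [s']
     is the look-alike of [s] that enabled [a]. *)
  apply: contrapT => nMsa; have /seteqP[sub _] := Mobs Ms aAc nMsa Lsa.
  apply: (sub (rcons s' a)); split=> //; exists s', a; split=> //.
    split=> //; exact/lang_words/pclosureM_lang/(pclosure_rcons Ms'a).
  exact/finset.set11.
elim/last_ind=> [_|s a IHs Msa]; first exact: closed_loop_nil.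
have Lsa := pclosureM_lang Msa.
apply: closed_loop_rcons => //; first exact/IHs/(pclosure_rcons Msa).
have := lang_words Lsa; rewrite /words /= all_rcons => /andP[aA _].
rewrite /= finset.inE; apply/andP; split=> //.
by apply/orP; right; apply/asboolP; exists s.
Qed.

Lemma permissive_closed_loop_marked :
  closed_loop_marked permissive_supervisor = M.
Proof. by rewrite /closed_loop_marked permissive_closed_loop -Mclosed. Qed.

Lemma permissive_nonblocking : nonblocking permissive_supervisor.
Proof.
by rewrite /nonblocking permissive_closed_loop_marked permissive_closed_loop.
Qed.

End Synthesis.

Lemma nonblocking_supervisorP (M : set (seq E)) :
  (exists2 S : supervisor G Ac Ao, nonblocking S & closed_loop_marked S = M) <->
  [/\ M !=set0, controllable (lang G) (A :\: Ac) M, mclosed (mlang G) M &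
      observable (lang G) Ac A Ao M].
Proof.
split=> [[S nbS <-]|[M0 Mctrl Mcl Mobs]].
  split; [exact: nonblocking_nonempty | exact: nonblocking_controllable
         | exact: nonblocking_mclosed | exact: nonblocking_observable].
exists (permissive_supervisor M).
  exact: permissive_nonblocking.
exact: permissive_closed_loop_marked.
Qed.

End SinglePlant.

(** Identifies the uncontrollable events of a local plant with its share of the global ones. *)
Lemma setD_setI_sub (T : finType) (A B C : {set T}) :
  A \subset B -> A :\: (A :&: C) = A :&: (B :\: C).
Proof.
move=> /fintype.subsetP AB; apply/finset.setP => a; rewrite !finset.inE.
by have [/AB ->|] := boolP (a \in A); rewrite ?andbT ?andbF.
Qed.

Theorem theorem7 (E : finType) (Sigma1 Sigma2 Sigmak Sigmac Sigmao : {set E})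
    (G1 : generator Sigma1) (G2 : generator Sigma2) (Gk : generator Sigmak)
    (hk_lower : Sigma1 :&: Sigma2 \subset Sigmak)
    (hk_upper : Sigmak \subset Sigma1 :|: Sigma2)
    (hc : Sigmac \subset Sigma1 :|: Sigma2)
    (ho : Sigmao \subset Sigma1 :|: Sigma2)
    (K : set (seq E))
    (hK : K `<=` mlang (sync (sync G1 G2) Gk))
    (hdec : cond_decomposable Sigma1 Sigma2 Sigmak K)
    (hdec_closure : cond_decomposable Sigma1 Sigma2 Sigmak (pclosure K)) :
  (exists (S1 : supervisor (sync G1 Gk) ((Sigma1 :|: Sigmak) :&: Sigmac)
                  ((Sigma1 :|: Sigmak) :&: Sigmao))
          (S2 : supervisor (sync G2 Gk) ((Sigma2 :|: Sigmak) :&: Sigmac)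
                  ((Sigma2 :|: Sigmak) :&: Sigmao)),
      [/\ nonblocking S1, nonblocking S2,
          closed_loop_marked S1 `<=` proj (Sigma1 :|: Sigmak) @` K,
          closed_loop_marked S2 `<=` proj (Sigma2 :|: Sigmak) @` K &
          parallel (Sigma1 :|: Sigmak) (Sigma2 :|: Sigmak)
            (closed_loop_marked S1) (closed_loop_marked S2) = K])
  <->
  [/\ cond_controllable G1 G2 Gk ((Sigma1 :|: Sigma2) :\: Sigmac) K,
      cond_closed G1 G2 Gk K &
      cond_observable G1 G2 Gk Sigmac Sigmao K].
Proof.
have sub1 : Sigma1 :|: Sigmak \subset Sigma1 :|: Sigma2.
  by rewrite finset.subUset finset.subsetUl.
have sub2 : Sigma2 :|: Sigmak \subset Sigma1 :|: Sigma2.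
  by rewrite finset.subUset finset.subsetUr.
rewrite /cond_controllable -(setD_setI_sub _ sub1) -(setD_setI_sub _ sub2).
split=> [[S1 [S2 [nb1 nb2 le1 le2 eqK]]]|[[c1 c2] [K0 m1 m2] [o1 o2]]].
  have e1 : closed_loop_marked S1 = proj (Sigma1 :|: Sigmak) @` K.
    apply/seteqP; split; first exact: le1.
    by rewrite -{1}eqK; exact: proj_parallel1.
  have e2 : closed_loop_marked S2 = proj (Sigma2 :|: Sigmak) @` K.
    apply/seteqP; split; first exact: le2.
    by rewrite -{1}eqK; exact: proj_parallel2.
  have [[_ [w Kw _]] c1 m1 o1] :=
    (nonblocking_supervisorP _ _ _ _).1 (ex_intro2 _ _ S1 nb1 e1).
  have [_ c2 m2 o2] :=
    (nonblocking_supervisorP _ _ _ _).1 (ex_intro2 _ _ S2 nb2 e2).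
  by split; split=> //; exists w.
have P0 B : proj B @` K !=set0 by case: K0 => w Kw; exists (proj B w), w.
have [S1 nb1 e1] :=
  (nonblocking_supervisorP _ _ _ _).2 (And4 (P0 _) c1 m1 o1).
have [S2 nb2 e2] :=
  (nonblocking_supervisorP _ _ _ _).2 (And4 (P0 _) c2 m2 o2).
(* The marked closed loops are the projections of [K], whose parallel composition is [K] by
   [hdec]. *)
by exists S1, S2; rewrite e1 e2 -hdec; split.
Qed.
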